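(* Let $I$ be an index set. Consider $I$-indexed multiposets, i.e. structures $(M,(\leq_i)_{i\in I})$ where each $\leq_i$ is a partial order on $M$. A family of coarseness conditions is a set $\mathcal F\subseteq I\times I$, and a multiposet satisfies $\mathcal F$ if $\leq_j\subseteq\leq_i$ (i.e. $\leq_i$ is coarser than $\leq_j$) for every $(i,j)\in\mathcal F$. (1) For every $\mathcal F\subseteq I\times I$, the class of all $I$-indexed multiposets satisfying $\mathcal F$ has SAPU; in fact it has superSAPU with respect to each $\leq_i$. (2) Let $J\subseteq I$ and $\mathcal F\subseteq I\times I$, and let $\mathcal K$ be the class of all $I$-indexed multiposets satisfying $\mathcal F$ in which $\leq_j$ is a linear order for every $j\in J$. Then $\mathcal K$ has SAPU. (3) In particular, the class of structures $(M,\leq,\leq')$ where $\leq$ is a partial order and $\leq'$ is a linear order with $\leq\subseteq\leq'$ has SAPU. Moreover, if $I$ is finite, then in each of the cases (1), (2), (3) the class of finite structures in the class has a Fraïssé limit $\mathbf M$, the first-order theory $Th(\mathbf M)$ is $\omega$-categorical and has quantifier elimination, and $Th(\mathbf M)$ is the model completion of the first-order theory axiomatizing the class under consideration.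
   Context: Embeddings are injective maps preserving and reflecting relations; $\mathbf A\subseteq\mathbf B$ means $A\subseteq B$ and inclusion is an embedding; classes are closed under isomorphism. A class $\mathcal K$ has SAPU if whenever $\mathbf A,\mathbf B,\mathbf C\in\mathcal K$ with $\mathbf C\subseteq\mathbf A$, $\mathbf C\subseteq\mathbf B$ and $C=A\cap B$, there is $\mathbf D\in\mathcal K$ with $\mathbf A\subseteq\mathbf D$, $\mathbf B\subseteq\mathbf D$ and $D=A\cup B$; it has superSAPU with respect to a binary relation $R$ if moreover $\mathbf D$ can be chosen so that for all $a\in A\setminus B$, $b\in B\setminus A$: $aR^{\mathbf D}b$ implies $aR^{\mathbf A}cR^{\mathbf B}b$ for some $c\in C$, and $bR^{\mathbf D}a$ implies $bR^{\mathbf B}cR^{\mathbf A}a$ for some $c\in C$. A Fraïssé limit of a class $\mathcal K$ of finitely generated structures in a countable language is a countable ultrahomogeneous structure whose age (class of finitely generated structures embeddable in it) is $\mathcal K$. *)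

(* Defs.v *)
From Stdlib Require Relation_Definitions.
From mathcomp Require Import all_boot all_classical.

Set Implicit Arguments.
Unset Strict Implicit.
Unset Printing Implicit Defensive.

Local Open Scope classical_set_scope.
Local Open Scope card_scope.

(** * Structures

The language has one binary relation symbol for each [i : I] and no other
symbol. Carriers may be empty. *)

Record structure (I : Type) := Structure {
  carrier :> Type;
  rel_of : I -> carrier -> carrier -> Prop }.

Definition class (I : Type) := structure I -> Prop.

Definition embedding (I : Type) (A B : structure I) (f : A -> B) : Prop :=
  injective f /\
  forall (i : I) (x y : A), rel_of i x y <-> rel_of i (f x) (f y).

Definition isomorphism (I : Type) (A B : structure I) (f : A -> B) : Prop :=
  bijective f /\ embedding f.

Definition isomorphic (I : Type) (A B : structure I) : Prop :=
  exists f : A -> B, isomorphism f.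

(** Structures whose domains are subsets of a common [U], so that inclusions,
intersections and unions of domains are meaningful. The values of [srel]
outside [dom] are irrelevant. *)

Record set_structure (I U : Type) := SetStructure {
  dom : set U;
  srel : I -> U -> U -> Prop }.

Definition as_structure (I U : Type) (A : set_structure I U) : structure I :=
  @Structure I {x : U | dom A x} (fun i x y => srel A i (sval x) (sval y)).

Coercion as_structure : set_structure >-> structure.

Definition substructure (I U : Type) (A B : set_structure I U) : Prop :=
  dom A `<=` dom B /\
  forall (i : I) (x y : U), dom A x -> dom A y -> (srel A i x y <-> srel B i x y).

Definition induced_on (I : Type) (M : structure I) (S : set M) :
    set_structure I M := SetStructure S (@rel_of I M).

(** * SAPU and superSAPU *)

Definition union_amalgam (I U : Type) (A B D : set_structure I U) : Prop :=
  [/\ substructure A D, substructure B D & dom D = dom A `|` dom B].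

Definition SAPU (I : Type) (K : class I) : Prop :=
  forall (U : Type) (A B C : set_structure I U),
    K A -> K B -> K C ->
    substructure C A -> substructure C B -> dom C = dom A `&` dom B ->
    exists D : set_structure I U, K D /\ union_amalgam A B D.

Definition superSAPU (I : Type) (r : I) (K : class I) : Prop :=
  forall (U : Type) (A B C : set_structure I U),
    K A -> K B -> K C ->
    substructure C A -> substructure C B -> dom C = dom A `&` dom B ->
    exists D : set_structure I U,
      [/\ K D, union_amalgam A B D &
        forall a b : U, (dom A `\` dom B) a -> (dom B `\` dom A) b ->
          (srel D r a b -> exists c, [/\ dom C c, srel A r a c & srel B r c b]) /\
          (srel D r b a -> exists c, [/\ dom C c, srel B r b c & srel A r c a])].

(** * Fraïssé limits *)

(** Without function symbols, the substructure generated by a set is that set,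
so finitely generated means finite. *)
Definition finitely_generated (I : Type) (A : structure I) : Prop :=
  finite_set [set: A].

Definition finite_members (I : Type) (K : class I) : class I :=
  fun A => K A /\ finite_set [set: A].

Definition age (I : Type) (M : structure I) : class I :=
  fun A => finitely_generated A /\ exists f : A -> M, embedding f.

Definition ultrahomogeneous (I : Type) (M : structure I) : Prop :=
  forall (S T : set M) (f : induced_on S -> induced_on T),
    finitely_generated (induced_on S) -> finitely_generated (induced_on T) ->
    isomorphism f ->
    exists g : M -> M,
      isomorphism g /\ forall x : induced_on S, g (sval x) = sval (f x).

Definition Fraisse_limit (I : Type) (K : class I) (M : structure I) : Prop :=
  [/\ countable [set: M], ultrahomogeneous M &
      forall A : structure I, age M A <-> K A].

(** * First-order logic *)

(** [formula I n] is the type of formulas whose free variables are among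
[x_0, ..., x_(n-1)]. The quantifier [FAll] binds variable [0] of its body,
whose variables [k.+1] are the variables [k] of the context. *)
Inductive formula (I : Type) (n : nat) : Type :=
| FFalse
| FEq of 'I_n & 'I_n
| FRel of I & 'I_n & 'I_n
| FImp of formula I n & formula I n
| FAll of formula I n.+1.

Definition extend (T : Type) (n : nat) (x : T) (v : 'I_n -> T) : 'I_n.+1 -> T :=
  fun k => if unlift ord0 k is Some j then v j else x.

Fixpoint sat (I : Type) (M : structure I) (n : nat) (phi : formula I n) :
    ('I_n -> M) -> Prop :=
  match phi with
  | FFalse => fun _ => False
  | FEq j k => fun v => v j = v k
  | FRel i j k => fun v => rel_of i (v j) (v k)
  | FImp psi chi => fun v => sat psi v -> sat chi v
  | FAll psi => fun v => forall x : M, sat psi (extend x v)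
  end.

Fixpoint quantifier_free (I : Type) (n : nat) (phi : formula I n) : Prop :=
  match phi with
  | FImp psi chi => quantifier_free psi /\ quantifier_free chi
  | FAll _ => False
  | _ => True
  end.

Definition sentence (I : Type) : Type := formula I 0.

Definition theory (I : Type) : Type := set (sentence I).

Definition satisfies (I : Type) (M : structure I) (phi : sentence I) : Prop :=
  forall v : 'I_0 -> M, sat phi v.

Definition models (I : Type) (M : structure I) (T : theory I) : Prop :=
  forall phi : sentence I, T phi -> satisfies M phi.

Definition Th (I : Type) (M : structure I) : theory I :=
  [set phi | satisfies M phi].

Definition axiomatizes (I : Type) (T : theory I) (K : class I) : Prop :=
  forall M : structure I, models M T <-> K M.

Definition countably_infinite (T : Type) : Prop := [set: T] #= [set: nat].

Definition omega_categorical (I : Type) (T : theory I) : Prop :=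
  (exists M : structure I, models M T /\ countably_infinite M) /\
  (forall M N : structure I,
     models M T -> countably_infinite M ->
     models N T -> countably_infinite N -> isomorphic M N).

Definition quantifier_elimination (I : Type) (T : theory I) : Prop :=
  forall (n : nat) (phi : formula I n),
    exists psi : formula I n, quantifier_free psi /\
      forall M : structure I, models M T ->
        forall v : 'I_n -> M, sat phi v <-> sat psi v.

(** Robinson's notion: [T'] extends [T], every model of [T] embeds into a model
of [T'], and [T'] together with the diagram of [A] is complete for every model
[A] of [T]. A model of [T'] and the diagram of [A] is a model [M] of [T'] with
an embedding [f] of [A] into [M], and a sentence with parameters from [A] is a
formula [phi] with an assignment [v] in [A]; the last clause says that any two
such models satisfy the same sentences with parameters. *)
Definition model_completion (I : Type) (T' T : theory I) : Prop :=
  [/\ forall M : structure I, models M T' -> models M T,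
      forall A : structure I, models A T ->
        exists (M : structure I) (f : A -> M), models M T' /\ embedding f &
      forall A : structure I, models A T ->
        forall (M N : structure I) (f : A -> M) (g : A -> N),
          models M T' -> models N T' -> embedding f -> embedding g ->
          forall (n : nat) (phi : formula I n) (v : 'I_n -> A),
            sat phi (f \o v) <-> sat phi (g \o v)].

(** * Multiposets *)

Definition partial_order (M : Type) (R : M -> M -> Prop) : Prop :=
  Relation_Definitions.order M R.

Definition linear_order (M : Type) (R : M -> M -> Prop) : Prop :=
  partial_order R /\ forall x y : M, R x y \/ R y x.

Definition multiposet (I : Type) : class I :=
  fun M => forall i : I, partial_order (@rel_of I M i).

(** [(i, j)] in [F] requires the order [i] to be coarser than the order [j]. *)
Definition coarseness (I : Type) (F : set (I * I)) : class I :=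
  fun M => forall i j : I, F (i, j) ->
    forall x y : M, rel_of j x y -> rel_of i x y.

Definition multiposets (I : Type) (F : set (I * I)) : class I :=
  fun M => multiposet M /\ coarseness F M.

Definition multiposets_linear (I : Type) (J : set I) (F : set (I * I)) :
    class I :=
  fun M => multiposets F M /\
    forall j : I, J j -> linear_order (@rel_of I M j).

Inductive order_symbol : Set := le_sym | le'_sym.

Definition linearly_extended_posets : class order_symbol :=
  fun M =>
    [/\ partial_order (@rel_of _ M le_sym),
        linear_order (@rel_of _ M le'_sym) &
        forall x y : M, rel_of le_sym x y -> rel_of le'_sym x y].

(** * The model-theoretic conclusion for a class *)

Definition has_generic_model_completion (I : Type) (K : class I) : Prop :=
  (exists M : structure I, Fraisse_limit (finite_members K) M) /\
  (exists T : theory I, axiomatizes T K) /\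
  (forall M : structure I, Fraisse_limit (finite_members K) M ->
     [/\ omega_categorical (Th M),
         quantifier_elimination (Th M) &
         forall T : theory I, axiomatizes T K -> model_completion (Th M) T]).

(* Main.v *)
(** Amalgam of multiposets: compose two steps, each inside one of the two parts;
for a symbol that is linear in both parts, put points that are still
incomparable in the order that has the left part first. Both recipes are
uniform in the relations and so preserve the coarseness conditions.

The class is determined by its finite members, so finite amalgamation over the
natural numbers, with every one-point extension requested infinitely often,
gives the Fraïssé limit [M]. As the language is finite, the type of a tuple is
expressed by one formula and homogeneity becomes a set of sentences of [Th(M)].
Back and forth between models of [Th(M)] then gives omega-categoricity and
quantifier elimination. A structure [A] of the class embeds into an ultrapower
of [M] over the finite tuples of [A], which makes [Th(M)] the model completion. *)

From Stdlib Require List.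
Require Import Defs.
From mathcomp Require Import all_boot all_classical.

Set Implicit Arguments.
Unset Strict Implicit.
Unset Printing Implicit Defensive.

Local Open Scope classical_set_scope.

(** * Quantifier-free types of tuples *)

(** Equality atoms are compared too, so sending [v j] to [w j] is a partial isomorphism even when
    the tuples repeat entries. *)
Definition same_type (I : Type) (A B : structure I) (n : nat)
    (v : 'I_n -> A) (w : 'I_n -> B) : Prop :=
  forall j k : 'I_n, (v j = v k <-> w j = w k) /\
    forall i : I, rel_of i (v j) (v k) <-> rel_of i (w j) (w k).

Lemma extend0 (T : Type) (n : nat) (x : T) (v : 'I_n -> T) :
  extend x v ord0 = x.
Proof. by rewrite /extend unlift_none. Qed.

Lemma extend_lift (T : Type) (n : nat) (x : T) (v : 'I_n -> T) (j : 'I_n) :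
  extend x v (lift ord0 j) = v j.
Proof. by rewrite /extend liftK. Qed.

Lemma extend_split (T : Type) (n : nat) (v : 'I_n.+1 -> T) :
  v = extend (v ord0) (v \o lift ord0).
Proof.
by apply/funext => k; rewrite /extend; case: unliftP => [j|] ->.
Qed.

Lemma comp_extend (T U : Type) (f : T -> U) (n : nat) (x : T) (v : 'I_n -> T) :
  f \o extend x v = extend (f x) (f \o v).
Proof.
by apply/funext => k; rewrite /extend /=; case: unliftP.
Qed.

Definition empty_tuple (T : Type) : 'I_0 -> T :=
  ffun0 (rT := fun=> T) (card_ord 0).

Section SameType.
Variable I : Type.
Implicit Types A B C M : structure I.

Lemma same_type0 A B (v : 'I_0 -> A) (w : 'I_0 -> B) : same_type v w.
Proof. by case. Qed.

Lemma same_type_sym A B n (v : 'I_n -> A) (w : 'I_n -> B) :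
  same_type v w -> same_type w v.
Proof. by move=> h j k; have [e r] := h j k; split=> [|i]; apply: iff_sym. Qed.

Lemma same_type_trans A B C n (v : 'I_n -> A) (w : 'I_n -> B) (u : 'I_n -> C) :
  same_type v w -> same_type w u -> same_type v u.
Proof.
move=> h h' j k; have [e r] := h j k; have [e' r'] := h' j k.
split=> [|i]; [exact: iff_trans e e'|exact: iff_trans (r i) (r' i)].
Qed.

Lemma same_type_comp A B n m (s : 'I_m -> 'I_n) (v : 'I_n -> A) (w : 'I_n -> B) :
  same_type v w -> same_type (v \o s) (w \o s).
Proof. by move=> h j k; exact: h. Qed.

Lemma same_type_behead A B n x y (v : 'I_n -> A) (w : 'I_n -> B) :
  same_type (extend x v) (extend y w) -> same_type v w.
Proof. by move=> h j k; have := h (lift ord0 j) (lift ord0 k); rewrite !extend_lift. Qed.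

Lemma embedding_same_type A B (f : A -> B) n (v : 'I_n -> A) :
  embedding f -> same_type v (f \o v).
Proof. by move=> [finj frel] j k; split=> [|i]; [split=> [/= ->|/finj]|exact: frel]. Qed.

(** The equality clause of [same_type] makes the value at [x] independent of the index chosen for
    [x]. *)
Lemma same_type_embedding A B n (v : 'I_n -> A) (w : 'I_n -> B) :
  same_type v w -> (forall x, exists k, v k = x) ->
  exists f : A -> B, embedding f /\ forall k, f (v k) = w k.
Proof.
move=> h /choice[e ve]; have fv k : w (e (v k)) = w k by apply/(h _ _).1.
exists (w \o e); split=> //; split=> [x y /= |i x y /=].
  by move/(h _ _).1; rewrite !ve.
by rewrite -{1}(ve x) -{1}(ve y); exact: (h _ _).2.
Qed.

Lemma inj_surj_bijective (T U : Type) (f : T -> U) :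
  injective f -> (forall y, exists x, f x = y) -> bijective f.
Proof. by move=> finj /choice[g fg]; exists g => // x; apply: finj. Qed.

Lemma same_type_isomorphism A B n (v : 'I_n -> A) (w : 'I_n -> B) :
  same_type v w -> (forall x, exists k, v k = x) ->
  (forall x, exists k, w k = x) ->
  exists f : A -> B, isomorphism f /\ forall k, f (v k) = w k.
Proof.
move=> h vs ws; have [f [fe fv]] := same_type_embedding h vs.
exists f; split=> //; split=> //; apply: (inj_surj_bijective fe.1) => y.
by have [k <-] := ws y; exists (v k).
Qed.

Lemma finite_setT_enum (T : Type) :
  finite_set [set: T] -> exists n (e : 'I_n -> T), forall x, exists k, e k = x.
Proof.
(* Listing a finite set by a sequence takes a decidable equality, which [Pchoice] supplies on any
   type. *)
elim/Pchoice: T => T /finite_seqP[s sT]; exists (size s), (tnth (in_tuple s)) => x.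
have /tnthP[k ->] : x \in in_tuple s by have : [set: T] x by []; rewrite sT.
by exists k.
Qed.

Lemma enum_finite_setT (T : Type) n (e : 'I_n -> T) :
  (forall x, exists k, e k = x) -> finite_set [set: T].
Proof.
move=> es; apply: (@sub_finite_set _ _ (range e)) => [x _|].
  by have [k <-] := es x; exists k.
exact/finite_image/finite_finset.
Qed.

Definition range_structure M n (v : 'I_n -> M) : set_structure I M :=
  induced_on (range v).

Definition range_tuple M n (v : 'I_n -> M) (k : 'I_n) : range_structure v :=
  exist _ (v k) (imageT v k).

Lemma range_tuple_surj M n (v : 'I_n -> M) x : exists k, range_tuple v k = x.
Proof. by case: x => x [k kI kx]; exists k; exact: eq_exist. Qed.

Lemma same_type_range M n (v : 'I_n -> M) : same_type v (range_tuple v).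
Proof.
move=> j k; split=> // ; split=> [vjk|[]//]; exact: eq_exist.
Qed.

Lemma range_structure_finite M n (v : 'I_n -> M) :
  finite_set [set: range_structure v].
Proof. exact: enum_finite_setT (@range_tuple_surj _ _ v). Qed.

Lemma induced_on_embedding M (S : set M) :
  embedding (fun x : induced_on S => sval x).
Proof. by split=> // x y /eq_sig_hprop; apply=> ? ? ?; exact: Prop_irrelevance. Qed.

End SameType.

(** * Back and forth *)

Section BackAndForth.
Variables (I : Type) (A B : structure I).

Definition forth : Prop :=
  forall n (v : 'I_n -> A) (w : 'I_n -> B), same_type v w ->
  forall a, exists b, same_type (extend a v) (extend b w).

End BackAndForth.

Record stage (I : Type) (A B : structure I) := Stage {
  stage_size : nat;
  stage_l : 'I_stage_size -> A;
  stage_r : 'I_stage_size -> B;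
  stageP : same_type stage_l stage_r }.

Arguments stageP {I A B} s.

Section BackAndForthIso.
Variables (I : Type) (A B : structure I).
Implicit Types s t : stage A B.

(** Stages are compared through these graphs, because an extended tuple has other indices for the
    same entries. *)
Definition matched s a b : Prop :=
  exists k : 'I_(stage_size s), stage_l k = a /\ stage_r k = b.

Lemma stage_step (fAB : forth A B) (fBA : forth B A) s a b :
  exists t, [/\ forall x y, matched s x y -> matched t x y,
    exists y, matched t a y & exists x, matched t x b].
Proof.
have [b' hb'] := fAB _ _ _ (stageP s) a.
have [a' /same_type_sym ha'] := fBA _ _ _ (same_type_sym hb') b.
exists (Stage ha'); split.
- move=> x y [k [<- <-]]; exists (lift ord0 (lift ord0 k)).
  by rewrite /= !extend_lift.
- by exists b', (lift ord0 ord0); rewrite /= !extend_lift !extend0.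
- by exists a', ord0; rewrite /= !extend0.
Qed.

(** Step [m] takes care of the elements numbered [m] on both sides; the union of the graphs of all
    stages is the isomorphism. *)
Lemma back_and_forth n (v : 'I_n -> A) (w : 'I_n -> B) :
  countable [set: A] -> countable [set: B] -> forth A B -> forth B A ->
  same_type v w ->
  exists f : A -> B, isomorphism f /\ forall k, f (v k) = w k.
Proof.
move=> /countable_injP[cA cAinj] /countable_injP[cB cBinj] fAB fBA vw.
have step (s : stage A B) (m : nat) : exists t : stage A B,
    [/\ forall x y, matched s x y -> matched t x y,
        forall a, cA a = m -> exists y, matched t a y &
        forall b, cB b = m -> exists x, matched t x b].
  have injA a a' : cA a = cA a' -> a = a' by move/cAinj; apply; rewrite inE.
  have injB b b' : cB b = cB b' -> b = b' by move/cBinj; apply; rewrite inE.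
  have [[a am]|na] := pselect (exists a, cA a = m);
    have [[b bm]|nb] := pselect (exists b, cB b = m).
  - have [t [st ta tb]] := stage_step fAB fBA s a b; exists t; split=> //.
      by move=> a'; rewrite -am => /injA->.
    by move=> b'; rewrite -bm => /injB->.
  (* Only [A] has an element numbered [m]; any partner of [a] can serve as the second element that
     [stage_step] asks for. *)
  - have [b _] := fAB _ _ _ (stageP s) a.
    have [t [st ta _]] := stage_step fAB fBA s a b; exists t; split=> //.
      by move=> a'; rewrite -am => /injA->.
    by move=> b' b'm; case: nb; exists b'.
  - have [a _] := fBA _ _ _ (same_type_sym (stageP s)) b.
    have [t [st _ tb]] := stage_step fAB fBA s a b; exists t; split=> //.
      by move=> a' a'm; case: na; exists a'.
    by move=> b'; rewrite -bm => /injB->.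
  - exists s; split=> // c cm; first by case: na; exists c.
    by case: nb; exists c.
have [next nextP] := choice (fun p : stage A B * nat => step p.1 p.2).
pose st := fix st m := if m is m'.+1 then next (st m', m') else Stage vw.
have st_mono m d x y : matched (st m) x y -> matched (st (m + d)) x y.
  elim: d => [|d IH]; rewrite ?addn0 // addnS => /IH.
  by have [h _ _] := nextP (st (m + d), m + d); exact: h.
pose G x y := exists m, matched (st m) x y.
(* Both pairs are matched at the common stage [m + m'], where [stageP] compares them. *)
have Gpair x y x' y' : G x y -> G x' y' ->
    (x = x' <-> y = y') /\ forall i, rel_of i x x' <-> rel_of i y y'.
  move=> [m /st_mono h] [m' /st_mono h'].
  have [k [<- <-]] := h m'; have := h' m; rewrite addnC => -[k' [<- <-]].
  exact: stageP.
have Gl a : exists b, G a b.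
  have [_ h _] := nextP (st (cA a), cA a).
  by have [b hb] := h a erefl; exists b, (cA a).+1.
have Gr b : exists a, G a b.
  have [_ _ h] := nextP (st (cB b), cB b).
  by have [a ha] := h b erefl; exists a, (cB b).+1.
have [f fG] := choice Gl.
have fE x y : G x y -> f x = y by move=> Gxy; apply/(Gpair _ _ _ _ (fG x) Gxy).1.
exists f; split; last by move=> k; apply: fE; exists 0, k.
have fe : embedding f.
  split=> [x y /(Gpair _ _ _ _ (fG x) (fG y)).1 //|i x y].
  exact: (Gpair _ _ _ _ (fG x) (fG y)).2.
split=> //; apply: (inj_surj_bijective fe.1) => b.
by have [a /fE] := Gr b; exists a.
Qed.

End BackAndForthIso.

(** * Formulas describing types of tuples *)

Section Formulas.
Variable I : Type.
Implicit Types M N : structure I.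

Definition FNot n (phi : formula I n) : formula I n := FImp phi (FFalse I n).

Definition FAnd n (phi psi : formula I n) : formula I n :=
  FNot (FImp phi (FNot psi)).

Definition FEx n (phi : formula I n.+1) : formula I n := FNot (FAll (FNot phi)).

Definition FConj n (T : Type) (s : seq T) (F : T -> formula I n) : formula I n :=
  foldr (fun t => FAnd (F t)) (FNot (FFalse I n)) s.

Fixpoint FClose n : formula I n -> sentence I :=
  if n is m.+1 then fun phi => FClose (FAll phi) else id.

Lemma sat_and M n (phi psi : formula I n) (v : 'I_n -> M) :
  sat (FAnd phi psi) v <-> sat phi v /\ sat psi v.
Proof.
rewrite /=; have [] := pselect (sat phi v); have [] := pselect (sat psi v); tauto.
Qed.

Lemma sat_ex M n (phi : formula I n.+1) (v : 'I_n -> M) :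
  sat (FEx phi) v <-> exists x, sat phi (extend x v).
Proof. by rewrite /= -[X in X <-> _]/(~ (forall x, ~ _)) not_existsP. Qed.

Lemma sat_conj M n (T : eqType) (s : seq T) (F : T -> formula I n) (v : 'I_n -> M) :
  sat (FConj s F) v <-> forall t, t \in s -> sat (F t) v.
Proof.
elim: s => [|t s IH]; first by split=> // _; rewrite /=.
rewrite -[FConj _ _]/(FAnd (F t) (FConj s F)) sat_and IH; split.
  by move=> [Ft Fs] u; rewrite inE => /predU1P[->|/Fs].
by move=> Fs; split=> [|u us]; apply: Fs; rewrite inE ?eqxx ?us ?orbT.
Qed.

Lemma satisfies_close M n (phi : formula I n) :
  satisfies M (FClose phi) <-> forall v : 'I_n -> M, sat phi v.
Proof.
elim: n phi => [//|n IH] phi /=; rewrite IH; split=> h v.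
  by rewrite (extend_split v); exact: h.
by move=> x; exact: h.
Qed.

Lemma sat_quantifier_free M N n (phi : formula I n) (v : 'I_n -> M) (w : 'I_n -> N) :
  quantifier_free phi -> same_type v w -> (sat phi v <-> sat phi w).
Proof.
move=> + vw; elim: n / phi v w vw => //= n.
- by move=> j k v w vw _; exact: (vw j k).1.
- by move=> i j k v w vw _; exact: (vw j k).2.
- move=> phi IHphi psi IHpsi v w vw [/(IHphi _ _ vw) hphi /(IHpsi _ _ vw) hpsi].
  by rewrite hphi hpsi.
Qed.

End Formulas.

(* As the language is finite, finitely many atoms determine the type of a tuple. *)
Section Atoms.
Variables (I : Type) (m : nat) (sym : 'I_m -> I).
Hypothesis sym_surj : forall i, exists p, sym p = i.
Implicit Types M N : structure I.

(** Codes form a finite type, so [enum] lists all atoms in [n] variables. *)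
Definition atom_code n : finType := ('I_n * 'I_n + 'I_m * 'I_n * 'I_n)%type.

Definition atom n (t : atom_code n) : formula I n :=
  match t with
  | inl (j, k) => FEq I j k
  | inr (p, j, k) => FRel (sym p) j k
  end.

Lemma atom_quantifier_free n (t : atom_code n) : quantifier_free (atom t).
Proof. by case: t => [[j k]|[[p j] k]]. Qed.

Lemma same_type_atoms M N n (v : 'I_n -> M) (w : 'I_n -> N) :
  same_type v w <-> forall t : atom_code n, sat (atom t) v <-> sat (atom t) w.
Proof.
split=> [vw t|h j k]; first exact: sat_quantifier_free (atom_quantifier_free t) vw.
split=> [|i]; first exact: (h (inl (j, k))).
by have [p <-] := sym_surj i; exact: (h (inr (p, j, k))).
Qed.

Definition type_formula M n (v : 'I_n -> M) : formula I n :=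
  FConj (enum (atom_code n))
    (fun t => if `[< sat (atom t) v >] then atom t else FNot (atom t)).

Lemma sat_type_formula M N n (v : 'I_n -> M) (w : 'I_n -> N) :
  sat (type_formula v) w <-> same_type v w.
Proof.
rewrite sat_conj same_type_atoms; split=> [h t|h t _].
  by have := h t (mem_enum _ _); case: asboolP => tv /=; tauto.
by have := h t; case: asboolP => tv /=; tauto.
Qed.

(* The Boolean function of the listed formulas that computes [P] is built by
Shannon expansion on the first formula of the list. *)
Lemma quantifier_free_definable n (L : seq (formula I n))
    (P : forall M, ('I_n -> M) -> Prop) :
  (forall phi, List.In phi L -> quantifier_free phi) ->
  (forall M N (v : 'I_n -> M) (w : 'I_n -> N),
     (forall phi, List.In phi L -> (sat phi v <-> sat phi w)) ->
     P M v -> P N w) ->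
  exists psi : formula I n, quantifier_free psi /\
    forall M (v : 'I_n -> M), P M v <-> sat psi v.
Proof.
elim: L P => [|phi L IH] P Lqf PL.
  (* With no formula left to consult, [P] holds of all tuples or of none. *)
  have [[M [v Pv]]|nP] := pselect (exists M v, P M v).
    exists (FNot (FFalse I n)); split=> // N w; split=> [_ []|_].
    exact: PL Pv.
  exists (FFalse I n); split=> // N w; split=> // Pw; apply: nP.
  by exists N, w.
(* The cofactor for the value [b] of [phi]: some tuple that agrees on [L] gives [phi] this value and
   satisfies [P]. *)
have IHb (b : bool) : exists psi : formula I n, quantifier_free psi /\
    forall M (v : 'I_n -> M),
    (exists N (w : 'I_n -> N),
      [/\ forall chi, List.In chi L -> (sat chi v <-> sat chi w),
      sat phi w <-> b & P N w]) <-> sat psi v.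
  apply: IH => [chi hchi|M M' v v' vv' [N [w [vw wb Pw]]]].
    by apply: Lqf; right.
  exists N, w; split=> // chi hchi.
  by have := vv' _ hchi; have := vw _ hchi; tauto.
have [psi1 [q1 h1]] := IHb true; have [psi0 [q0 h0]] := IHb false.
exists (FAnd (FImp phi psi1) (FImp (FNot phi) psi0)); split.
  by do !split=> //; apply: Lqf; left.
have agree b M N (v : 'I_n -> M) (w : 'I_n -> N) :
    (sat phi v <-> b) -> (sat phi w <-> b) ->
    (forall chi, List.In chi L -> (sat chi v <-> sat chi w)) -> P M v -> P N w.
  move=> vb wb vw; apply: PL => chi [<-|/vw//]; exact: iff_trans vb (iff_sym wb).
move=> M v; rewrite sat_and; have [vphi|nvphi] := pselect (sat phi v).
  have vb : sat phi v <-> true by split.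
  split=> [Pv|[/(_ vphi) /h1[N [w [vw wb Pw]]] _]].
    by split=> [_|/= /(_ vphi)//]; apply/h1; exists M, v; split.
  have wv chi (hchi : List.In chi L) := iff_sym (vw chi hchi).
  exact: agree wb vb wv Pw.
have vb : sat phi v <-> false by split.
split=> [Pv|[_ /(_ nvphi)/h0[N [w [vw wb Pw]]]]].
  by split=> [/nvphi//|_]; apply/h0; exists M, v; split.
have wv chi (hchi : List.In chi L) := iff_sym (vw chi hchi).
exact: agree wb vb wv Pw.
Qed.

Lemma type_invariant_definable n (P : forall M, ('I_n -> M) -> Prop) :
  (forall M N (v : 'I_n -> M) (w : 'I_n -> N), same_type v w -> P M v -> P N w) ->
  exists psi : formula I n, quantifier_free psi /\
    forall M (v : 'I_n -> M), P M v <-> sat psi v.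
Proof.
move=> Pinv; apply: (@quantifier_free_definable n (map (@atom n) (enum (atom_code n)))).
  by move=> phi /List.in_map_iff[t [<- _]]; exact: atom_quantifier_free.
move=> M N v w vw; apply: Pinv; apply/same_type_atoms => t; apply: vw.
apply/List.in_map_iff; exists t; split=> //.
have : t \in enum (atom_code n) by rewrite mem_enum.
by elim: (enum _) => //= u s IH; rewrite inE => /predU1P[->|/IH]; [left|right].
Qed.

End Atoms.

(** * Local classes and their Fraïssé limits *)

(** The hypothesis [locally K M -> K M] expresses that [K] is closed under substructures and
    determined by its finite members. *)
Definition locally (I : Type) (K : class I) : class I := fun M =>
  forall n (v : 'I_n -> M), exists (B : structure I) (w : 'I_n -> B),
    K B /\ same_type v w.

Section LocalClass.
Variables (I : Type) (K : class I).
Hypothesis K_local : forall M, locally K M -> K M.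
Implicit Types A B M N : structure I.

Lemma local_embedding A B (f : A -> B) : embedding f -> K B -> K A.
Proof.
move=> fe KB; apply: K_local => n v.
by exists B, (f \o v); split=> //; exact: embedding_same_type.
Qed.

Lemma local_range M n (v : 'I_n -> M) : K M -> K (range_structure v).
Proof. exact: local_embedding (induced_on_embedding (range v)). Qed.

Section Limit.
Variable M : structure I.
Hypothesis M_limit : Fraisse_limit (finite_members K) M.

(** Finite parts of [M] belong to its age, hence to [K], and [K] is local. *)
Lemma limit_in_class : K M.
Proof.
have [_ _ ageM] := M_limit; apply: K_local => n v.
exists (range_structure v), (range_tuple v); split; last exact: same_type_range.
suff /ageM[] : age M (range_structure v) by [].
split; first exact: range_structure_finite.
by eexists; exact: induced_on_embedding.
Qed.

Lemma limit_realizes B n (w : 'I_n -> B) :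
  K B -> exists v : 'I_n -> M, same_type w v.
Proof.
have [_ _ ageM] := M_limit => KB.
have /ageM[_ [f fe]] : finite_members K (range_structure w).
  by split; [exact: local_range|exact: range_structure_finite].
exists (f \o range_tuple w).
exact: same_type_trans (same_type_range w) (embedding_same_type _ fe).
Qed.

(** Ultrahomogeneity extends the isomorphism between the two ranges to an automorphism, whose value
    at [a] is the required point. *)
Lemma limit_forth : forth M M.
Proof.
have [_ homM _] := M_limit => n v w vw a.
have vw' : same_type (range_tuple v) (range_tuple w).
  apply: same_type_trans (same_type_range w).
  exact: same_type_trans (same_type_sym (same_type_range v)) vw.
have [f [fiso fv]] :=
  same_type_isomorphism vw' (@range_tuple_surj _ _ _ v) (@range_tuple_surj _ _ _ w).
have [g [[_ ge] gf]] :=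
  homM _ _ f (range_structure_finite v) (range_structure_finite w) fiso.
exists (g a); rewrite (_ : w = g \o v); last first.
  by apply/funext => k; rewrite /= (gf (range_tuple v k)) fv.
by rewrite -comp_extend; exact: embedding_same_type.
Qed.

End Limit.

Variables (m : nat) (sym : 'I_m -> I).
Hypothesis sym_surj : forall i, exists p, sym p = i.

Definition forbidden_types : theory I := fun phi =>
  exists N n (w : 'I_n -> N), phi = FClose (FNot (type_formula sym w)) /\
    forall B (u : 'I_n -> B), K B -> ~ same_type w u.

(** A model avoids every type that members of [K] omit, so each of its finite tuples has the type of
    a tuple in a member of [K]. *)
Lemma local_axiomatizes : axiomatizes forbidden_types K.
Proof.
move=> N; split=> [NT|KN phi [M [n [w [-> wK]]]]]; last first.
  by apply/satisfies_close => u /(sat_type_formula sym_surj); exact: wK.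
apply: K_local => n w; apply: contrapT => nB.
have /NT/satisfies_close/(_ w) : forbidden_types (FClose (FNot (type_formula sym w))).
  exists N, n, w; split=> // B u KB wu; apply: nB.
  by exists B, u.
by apply; exact/(sat_type_formula sym_surj).
Qed.

(** * The first-order theory of a Fraïssé limit *)

Section LimitTheory.
Variable M : structure I.
Hypothesis M_limit : Fraisse_limit (finite_members K) M.

(** Otherwise the universal sentence excluding the type of [w] would belong to [Th M]. *)
Lemma model_realized N n (w : 'I_n -> N) :
  models N (Th M) -> exists v : 'I_n -> M, same_type w v.
Proof.
move=> NM; apply: contrapT => nv.
have /NM/satisfies_close/(_ w) : Th M (FClose (FNot (type_formula sym w))).
  apply/satisfies_close => v /(sat_type_formula sym_surj) wv.
  by apply: nv; exists v.
by apply; exact/(sat_type_formula sym_surj).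
Qed.

(** The types of [w] and of its extension by [x] are realized in [M]. By [limit_forth], that every
    tuple of the first type extends to one of the second is a sentence of [Th M], and [N'] satisfies
    it. *)
Lemma model_forth N N' : models N (Th M) -> models N' (Th M) -> forth N N'.
Proof.
move=> NM N'M n w w' ww' x.
have [u /[dup] xwu] := model_realized (extend x w) NM.
rewrite {1}(extend_split u) => /same_type_behead wv.
set y := u ord0 in wv; set v := u \o lift ord0 in wv.
have : Th M (FClose (FImp (type_formula sym v) (FEx (type_formula sym u)))).
  apply/satisfies_close => v' /(sat_type_formula sym_surj) vv'.
  have [b hb] := limit_forth M_limit vv' y.
  apply/sat_ex; exists b; apply/(sat_type_formula sym_surj).
  by rewrite (extend_split u).
move=> /N'M/satisfies_close/(_ w')/=.
case/(_ _)/sat_ex; first apply/(sat_type_formula sym_surj).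
  exact: same_type_trans (same_type_sym wv) ww'.
move=> x' /(sat_type_formula sym_surj) ux'; exists x'.
exact: same_type_trans xwu ux'.
Qed.

Lemma model_sat_same_type N N' n (phi : formula I n) (w : 'I_n -> N) (w' : 'I_n -> N') :
  models N (Th M) -> models N' (Th M) -> same_type w w' ->
  sat phi w <-> sat phi w'.
Proof.
move=> NM N'M ww'.
elim: n / phi w w' ww' => [n|n j k|n i j k|n phi IHphi psi IHpsi|n phi IH] w w' ww';
  try exact: sat_quantifier_free ww'.
  by rewrite /= (IHphi _ _ ww') (IHpsi _ _ ww').
split=> h x.
  by have [y yx] := model_forth N'M NM (same_type_sym ww') x;
    apply/(IH _ _ (same_type_sym yx))/h.
by have [y xy] := model_forth NM N'M ww' x; apply/(IH _ _ xy)/h.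
Qed.

Lemma limit_quantifier_elimination : quantifier_elimination (Th M).
Proof.
move=> n phi.
(* Definability needs a property of tuples in arbitrary structures, so [P] passes to a tuple of the
   same type in a model. *)
pose P N (w : 'I_n -> N) := exists N' (w' : 'I_n -> N'),
  [/\ models N' (Th M), same_type w w' & sat phi w'].
have [|psi [qf h]] := @type_invariant_definable _ _ _ sym_surj n P.
  move=> N N' w w' ww' [M' [u [M'M wu phiu]]]; exists M', u; split=> //.
  exact: same_type_trans (same_type_sym ww') wu.
exists psi; split=> // N NM w; rewrite -h; split=> [phiw|[N' [w' [N'M ww' phiw']]]].
  by exists N, w; split=> // j k.
exact/(model_sat_same_type phi NM N'M ww').
Qed.

Lemma limit_omega_categorical :
  infinite_set [set: M] -> omega_categorical (Th M).
Proof.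
move=> Minf; split.
  exists M; split=> //; apply: eq_card_nat => //.
  by have [] := M_limit.
move=> N N' NM Nc N'M N'c.
have cnt (T : Type) : countably_infinite T -> countable [set: T].
  by move=> /card_le_eql leT; rewrite /countable leT.
have [f [fiso _]] := back_and_forth (cnt _ Nc) (cnt _ N'c)
  (model_forth NM N'M) (model_forth N'M NM) 
  (same_type0 (@empty_tuple N) (@empty_tuple N')).
by exists f.
Qed.

End LimitTheory.
End LocalClass.

(** * Ultrapowers *)

Section Ultrapower.
Variables (I X : Type) (U : set_system X) (M : structure I).
Hypothesis U_ultra : UltraFilter U.

(** The class of [f] is a set of functions, so that functions agreeing on a set of [U] have
    literally equal classes. *)
Definition germ (f : X -> M) : set (X -> M) := [set g | U [set x | f x = g x]].

Definition germs : Type := {C : set (X -> M) | exists f, C = germ f}.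

Definition germ_of (f : X -> M) : germs := exist _ (germ f) (ex_intro _ f erefl).

Definition germ_repr (C : germs) : X -> M := sval (cid (svalP C)).

Definition ultrapower : structure I :=
  Structure (fun i (C D : germs) =>
    U [set x | rel_of i (germ_repr C x) (germ_repr D x)]).

Lemma germ_reprK (C : germs) : germ_of (germ_repr C) = C.
Proof.
by case: C => C Cf; apply: eq_exist; rewrite /germ_repr; case: cid => f /= ->.
Qed.

Lemma germ_ofP (f g : X -> M) : germ_of f = germ_of g <-> U [set x | f x = g x].
Proof.
split=> [[fg]|Ufg].
  have : germ g g by exact: filterE.
  by rewrite -fg.
apply: eq_exist; apply/seteqP; split=> h /= Uh;
  by apply: filterS2 Ufg Uh => x /= ->.
Qed.

Lemma ultra_not (S : set X) : U (~` S) <-> ~ U S.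
Proof.
split=> [UnS US|nUS]; last by case: (in_ultra_setVsetC S U_ultra).
by apply: (filter_not_empty U); apply: filterS2 UnS US.
Qed.

(** Łoś's theorem: implication rests on [ultra_not], the quantifier on a choice of
    counterexamples. *)
Lemma Los n (phi : formula I n) (v : 'I_n -> ultrapower) :
  sat phi v <-> U [set x | sat phi (fun k => germ_repr (v k) x)].
Proof.
elim: n / phi v => [n|n j k|n i j k|n phi IHphi psi IHpsi|n phi IH] v //=.
- by split=> // /filter_not_empty.
- by rewrite -germ_ofP !germ_reprK.
- rewrite IHphi IHpsi; split=> [h|Uimp Uphi]; last first.
    by apply: filterS2 Uimp Uphi => x; exact.
  have [/h|] := pselect (U [set x | sat phi (fun k => germ_repr (v k) x)]).
    by apply: filterS => x /= ? _.
  by move/ultra_not; apply: filterS => x /= nphi /nphi.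
- have extE x (C : ultrapower) : (fun k => germ_repr (extend C v k) x) =
      extend (germ_repr C x) (fun k => germ_repr (v k) x).
    exact: (comp_extend (fun D : germs => germ_repr D x)).
  split=> [h|Uall C]; last first.
    by apply/IH; apply: filterS Uall => x /= hx; rewrite extE.
  apply: contrapT => /ultra_not Un.
  have /choice[f fP] (x : X) : exists y : M,
      (~ forall z, sat phi (extend z (fun k => germ_repr (v k) x))) ->
      ~ sat phi (extend y (fun k => germ_repr (v k) x)).
    have [/existsNP[y ny]|nall] :=
      pselect (~ forall z, sat phi (extend z (fun k => germ_repr (v k) x))).
      by exists y.
    (* An index without counterexample gets an arbitrary point of [M]; a counterexample at another
       index provides one. *)
    have [x' /existsNP[y _]] := filter_ex Un.
    by exists y.
  have /IH := h (germ_of f); apply/ultra_not.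
  have /germ_ofP := germ_reprK (germ_of f).
  apply: filterS2 Un => x /= nall fx; rewrite extE fx; exact: fP.
Qed.

Lemma ultrapower_models : models ultrapower (Th M).
Proof.
move=> phi Mphi v; apply/Los; apply: filterE => x; exact: Mphi.
Qed.

End Ultrapower.

(* The index set consists of the finite tuples of [A], filtered by inclusion of
their ranges. *)
Lemma embedding_into_model (I : Type) (A M : structure I) :
  inhabited M ->
  (forall n (v : 'I_n -> A), exists w : 'I_n -> M, same_type v w) ->
  exists (N : structure I) (f : A -> N), models N (Th M) /\ embedding f.
Proof.
move=> [x0] realized.
pose X := {n & 'I_n -> A}.
pose F : set_system X := fun S =>
  exists y : X, forall z : X, range (projT2 y) `<=` range (projT2 z) -> S z.
have FP : ProperFilter F.
  split; first by move=> [y /(_ y)]; apply.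
  split=> [|S S' [[n v] hS] [[n' v'] hS']|S S' SS' [y yS]].
  - by exists (existT _ 0 (@empty_tuple A)).
  (* The range of the concatenated tuple is the union of the two ranges. *)
  - exists (existT (fun n => 'I_n -> A) (n + n') (fun k =>
      match fintype.split k with inl j => v j | inr j => v' j end)).
    move=> z vz; split.
      apply: hS => _ [j _ <-]; apply: vz; exists (lshift n' j) => //=.
      by rewrite (unsplitK (inl j)).
    apply: hS' => _ [j _ <-]; apply: vz; exists (rshift n j) => //=.
    by rewrite (unsplitK (inr j)).
  - by exists y => z /yS/SS'.
have [U [UU FU]] := ultraFilterLemma FP.
have /choice[h hP] (y : X) : exists h : A -> M, same_type (projT2 y) (h \o projT2 y).
  move: y => [n v] /=; have [w vw] := realized n v.
  (* Off the range of [v] the map takes the default value [x0]. *)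
  have /choice[h hP] (a : A) : exists b, forall k, v k = a -> w k = b.
    have [[k ka]|nk] := pselect (exists k, v k = a).
      by exists (w k) => j ja; apply/(vw j k).1; rewrite ja.
    by exists x0 => k ka; case: nk; exists k.
  exists h; rewrite (_ : h \o v = w) //; apply/funext => k /=.
  exact/esym/hP.
pose g (a : A) (y : X) := h y a.
(* A property that holds as soon as [a] and [b] both occur in the tuple holds on a set of [F],
   witnessed by the pair of [a] and [b]. *)
have Uboth a b (P : X -> Prop) :
    (forall y, ((h y a = h y b <-> a = b) /\
       forall i, rel_of i a b <-> rel_of i (h y a) (h y b)) -> P y) -> U P.
  move=> hPy; apply: FU.
  exists (existT (fun n => 'I_n -> A) 2
    (fun k : 'I_2 => if k == ord0 then a else b)) => -[n v] /= sub.
  have [j _ ja] : range v a by apply: sub; exists ord0.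
  have [k _ kb] : range v b by apply: sub; exists (lift ord0 ord0).
  apply: hPy; have := hP (existT _ n v) j k; rewrite /= ja kb => -[e r].
  by split=> //; exact: iff_sym.
exists (ultrapower U M), (fun a => germ_of U (g a)).
split; first exact: ultrapower_models.
split=> [a b /(germ_ofP UU) gab|i a b].
  apply: contrapT => nab; have : U [set y | g a y <> g b y].
    by apply: (Uboth a b) => y [e _] /e.
  by move/(ultra_not UU).
have /(germ_ofP UU) ra := germ_reprK (germ_of U (g a)).
have /(germ_ofP UU) rb := germ_reprK (germ_of U (g b)).
split=> /= rab.
  have : U [set y | rel_of i (g a y) (g b y)].
    by apply: (Uboth a b) => y [_ r]; exact/r.
  move=> Ur; apply: filterS3 ra rb Ur => y /= -> -> //.
apply: contrapT => nab.
have Un : U [set y | ~ rel_of i (g a y) (g b y)].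
  by apply: (Uboth a b) => y [_ r] /r.
have : U (fun=> False).
  by apply: filterS3 ra rb (filterI rab Un) => y /= <- <- [].
exact: filter_not_empty.
Qed.

(** * Existence of the Fraïssé limit *)

Lemma substructure_embedding (I U : Type) (A B : set_structure I U) :
  substructure A B -> exists f : A -> B, embedding f /\ forall x, sval (f x) = sval x.
Proof.
move=> [sub rel]; exists (fun x : A => exist _ (sval x) (sub _ (svalP x)) : B).
split=> //; split=> [x y [] xy|i [x Ax] [y Ay]]; last exact: rel.
by apply: eq_sig_hprop xy => ? ? ?; exact: Prop_irrelevance.
Qed.

Section LimitExistence.
Variables (I : Type) (K : class I).
Hypothesis K_local : forall M, locally K M -> K M.
Hypothesis K_SAPU : SAPU K.
Hypothesis K_inhabited : exists B, K B.

(** The structure pulled back along [g] to [S] and [p] meets [A] in [S]. As [SAPU] adds no points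
    beyond the union, the amalgam gains only [p]. *)
Lemma one_point_extension (U : Type) (A : set_structure I U) (S : set U) (p : U)
    (B : structure I) (g : U -> B) :
  K A -> K B -> S `<=` dom A -> ~ dom A p ->
  (forall x y, (p |` S) x -> (p |` S) y -> g x = g y -> x = y) ->
  (forall i x y, S x -> S y -> (srel A i x y <-> rel_of i (g x) (g y))) ->
  exists D : set_structure I U,
    [/\ K D, substructure A D, dom D = p |` dom A &
      forall i x y, (p |` S) x -> (p |` S) y ->
        (srel D i x y <-> rel_of i (g x) (g y))].
Proof.
move=> KA KB SA pA ginj grel.
pose B' := SetStructure (p |` S) (fun i x y => rel_of i (g x) (g y)).
pose C := SetStructure S (srel A).
have KB' : K B'.
  apply: (local_embedding K_local (f := fun x : B' => g (sval x))) KB.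
  split=> [[x Bx] [y By] /= gxy|//].
  exact/eq_exist/ginj.
have CA : substructure C A by split.
have CB : substructure C B' by split=> [x Sx|//]; right.
have KC : K C by have [f [fe _]] := substructure_embedding CA; exact: local_embedding fe KA.
have CE : dom C = dom A `&` dom B'.
  by apply/seteqP; split=> [x Sx|x [Ax [xp|//]]]; [split; [exact: SA|right]|rewrite -xp in pA].
have [D [KD [AD [_ BD] DE]]] := K_SAPU KA KB' KC CA CB CE.
exists D; split=> //.
  rewrite DE; apply/seteqP; split=> [x [|[|/SA]]|x [|]]; by [left|right|right; left|left; right|right].
by move=> i x y Sx Sy; apply: iff_sym; exact: BD.
Qed.

Variables (m : nat) (code : I -> nat).
Hypothesis code_inj : injective code.
Hypothesis code_bound : forall i, code i < m.

(* A request [(s, R)] asks for a new point, named [None], whose relations to the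
points of [s] and to itself are those listed in [R], the symbol [i] being
written [code i]. *)
Definition request : countType :=
  (seq (option nat) * seq (nat * option nat * option nat))%type.

Definition granted (p : nat) (t : request) (D : set_structure I nat) : Prop :=
  dom D p /\ forall i x y, x \in t.1 -> y \in t.1 ->
    (srel D i (odflt p x) (odflt p y) <-> (code i, x, y) \in t.2).

Definition answer (p : nat) (t : request) (A D : set_structure I nat) : Prop :=
  [/\ K D, substructure A D, dom D `<=` p |` dom A & granted p t D].

(* Every request is made at infinitely many stages, namely at [2 ^ k * 3 ^ l] for
its number [k] and all [l]. *)
Definition next_stage (p : nat) (A : set_structure I nat) : set_structure I nat :=
  if unpickle (logn 2 p) is Some t then
    if pselect (exists D, answer p t A D) is left h then sval (cid h) else A
  else A.

Fixpoint approx (n : nat) : set_structure I nat :=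
  if n is p.+1 then next_stage p (approx p)
  else SetStructure set0 (fun _ _ _ => False).

Lemma substructure_refl (A : set_structure I nat) : substructure A A.
Proof. by split. Qed.

Lemma substructure_trans (A B C : set_structure I nat) :
  substructure A B -> substructure B C -> substructure A C.
Proof.
move=> [AB rAB] [BC rBC]; split=> [|i x y Ax Ay]; first exact: subset_trans BC.
by rewrite rAB // rBC //; exact: AB.
Qed.

Lemma next_stageP p (A : set_structure I nat) : K A ->
  [/\ K (next_stage p A), substructure A (next_stage p A) &
      dom (next_stage p A) `<=` p |` dom A].
Proof.
move=> KA; have keepA : [/\ K A, substructure A A & dom A `<=` p |` dom A].
  by split=> //; exact: substructure_refl.
rewrite /next_stage; case: unpickle => [t|//]; case: pselect => [h|//].
by case: cid => D [].
Qed.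

Lemma approx_class n : K (approx n).
Proof.
elim: n => [|n /(next_stageP n)[]//].
apply: K_local; case=> [|n] v; last by case: (v ord0).
have [B KB] := K_inhabited; exists B, (@empty_tuple B).
by split=> //; exact: same_type0.
Qed.

(** Stage [p] can add only the point [p], which is therefore new at that stage. *)
Lemma approx_bound n x : dom (approx n) x -> x < n.
Proof.
elim: n => [//|n IH] /=; have [_ _ sub] := next_stageP n (approx_class n).
by move=> /sub[->//|/IH/ltnW].
Qed.

Lemma approx_mono n n' : n <= n' -> substructure (approx n) (approx n').
Proof.
move=> /subnK <-; elim: (n' - n) => [|d IH]; first exact: substructure_refl.
apply: substructure_trans IH _.
by have [] := next_stageP (d + n) (approx_class (d + n)).
Qed.

Definition approx_union : set_structure I nat :=
  SetStructure (fun x => exists n, dom (approx n) x)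
    (fun i x y => exists n,
      [/\ dom (approx n) x, dom (approx n) y & srel (approx n) i x y]).

Lemma approx_sub_union n : substructure (approx n) approx_union.
Proof.
split=> [x Ax|i x y Ax Ay]; first by exists n.
split=> [|[n' [A'x A'y]]]; first by exists n.
have [_ r] := approx_mono (leq_maxl n n'); have [_ r'] := approx_mono (leq_maxr n n').
by rewrite (r i x y Ax Ay) (r' i x y A'x A'y).
Qed.

Lemma approx_union_tuple n (v : 'I_n -> approx_union) :
  exists l, forall k, dom (approx l) (sval (v k)).
Proof.
have /choice[f fP] (k : 'I_n) : exists l, dom (approx l) (sval (v k)) := svalP (v k).
exists (\max_k f k) => k.
by have [sub _] := approx_mono (leq_bigmax k : f k <= \max_k f k); apply: sub.
Qed.

Lemma approx_union_class : K approx_union.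
Proof.
apply: K_local => n v; have [l vl] := approx_union_tuple v.
have [f [fe fE]] := substructure_embedding (approx_sub_union l).
exists (approx l), (fun k => exist _ (sval (v k)) (vl k)).
split; first exact: approx_class.
apply: same_type_sym.
rewrite [X in same_type _ X](_ : v = f \o (fun k => exist _ (sval (v k)) (vl k))).
  exact: embedding_same_type.
apply/funext => k; apply: eq_sig_hprop => [? ? ?|]; first exact: Prop_irrelevance.
by rewrite /= fE.
Qed.

(** The type of [b] over [w] becomes a request made at a stage after all entries of [v] have
    appeared. [one_point_extension] shows that it has an answer, so that stage grants it. *)
Lemma approx_union_forth B : K B -> forth B approx_union.
Proof.
move=> KB n w v wv b.
have [[k <-]|nb] := pselect (exists k, w k = b).
  (* If [b] is already the entry [w k], its partner is [v k], and both tuples are reindexed to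
     repeat entry [k] in front. *)
  exists (v k); have := same_type_comp (fun j => odflt k (unlift ord0 j)) wv.
  have E T (u : 'I_n -> T) : u \o (fun j => odflt k (unlift ord0 j)) = extend (u k) u.
    by apply/funext => j; rewrite /extend /=; case: unliftP.
  by rewrite !E.
have vinj j k : sval (v j) = sval (v k) -> w j = w k.
  move=> vjk; apply/(wv j k).1.
  by apply: eq_sig_hprop vjk => ? ? ?; exact: Prop_irrelevance.
have [l vl] := approx_union_tuple v.
have /choice[g gP] (x : nat) : exists c, forall k, sval (v k) = x -> w k = c.
  have [[k kx]|nk] := pselect (exists k, sval (v k) = x).
    by exists (w k) => j jx; apply: vinj; rewrite jx.
  by exists b => k kx; case: nk; exists k.
pose g' (x : option nat) := oapp g b x.
pose s := None :: [seq Some (sval (v k)) | k <- enum 'I_n].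
have sv k : Some (sval (v k)) \in s.
  by rewrite inE /=; apply: map_f; rewrite mem_enum.
pose R := [seq z <- [seq (q, y) | q <- [seq (q, x) | q <- iota 0 m, x <- s], y <- s] |
  `[< exists i, code i = z.1.1 /\ rel_of i (g' z.1.2) (g' z.2) >]].
have RP i x y : x \in s -> y \in s ->
    ((code i, x, y) \in R <-> rel_of i (g' x) (g' y)).
  move=> xs ys; rewrite mem_filter; split=> [/andP[/asboolP[j [/code_inj <-]]//]|rxy].
  apply/andP; split; first by apply/asboolP; exists i.
  by apply: allpairs_f => //; apply: allpairs_f => //; rewrite mem_iota code_bound.
(* The factor [3 ^ l] puts the stage after [l] without changing the exponent of 2, which encodes the
   request. *)
pose t : request := (s, R); pose p := 2 ^ pickle t * 3 ^ l.
have tp : unpickle (logn 2 p) = Some t.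
  by rewrite /p lognM ?expn_gt0 // !lognX muln0 muln1 addn0 pickleK.
have lp : l <= p.
  by apply: leq_trans (ltnW (ltn_expl l (isT : 1 < 3))) _; rewrite leq_pmull ?expn_gt0.
have vp k : dom (approx p) (sval (v k)) by have [sub _] := approx_mono lp; exact: sub.
have pA : ~ dom (approx p) p by move=> /approx_bound; rewrite ltnn.
have vnp k : (sval (v k) == p) = false by apply/eqP => E; apply: pA; have := vp k; rewrite E.
pose gp x := if x == p then b else g x.
have gpv k : gp (sval (v k)) = w k by rewrite /gp vnp; exact/esym/gP.
have gpp : gp p = b by rewrite /gp eqxx.
have [|||D [KD AD DE Dr]] := @one_point_extension _ (approx p)
    (fun x => exists k, sval (v k) = x) p B gp (approx_class p) KB _ pA.
- by move=> _ [k <-].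
- move=> x y [->|[j <-]] [->|[k <-]] //; rewrite ?gpp ?gpv.
  + by move=> bw; case: nb; exists k.
  + by move=> bw; case: nb; exists j.
  + by move/(wv j k).1 => ->.
- move=> i _ _ [j <-] [k <-]; rewrite !gpv (wv j k).2.
  have [_ r] := approx_sub_union p; exact: r.
have grD : granted p t D.
  split=> [|i x y xs ys]; first by rewrite DE; left.
  have names z : z \in s -> (p |` (fun x => exists k, sval (v k) = x)) (odflt p z) /\
      gp (odflt p z) = g' z.
    rewrite inE => /predU1P[->|/mapP[k _ ->]] /=; first by split=> //; left.
    by split; [right; exists k|rewrite gpv; exact: gP].
  have [xD xg] := names x xs; have [yD yg] := names y ys.
  by rewrite RP // -xg -yg; exact: Dr.
(* The stage may choose an answer other than [D], but that answer grants [t] as well. *)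
have [Ap gr] : granted p t (approx p.+1).
  rewrite /= /next_stage tp; case: pselect => [h|[]]; first by case: cid => D' [].
  by exists D; split=> //; rewrite DE.
have [sub r] := approx_sub_union p.+1.
have Av k : dom (approx p.+1) (sval (v k)).
  by have [sub' _] := approx_mono (leqnSn p); exact: sub'.
exists (exist _ p (sub p Ap)) => j k.
have eqE (x y : approx_union) : x = y <-> sval x = sval y.
  by split=> [->//|/eq_sig_hprop]; apply=> ? ? ?; exact: Prop_irrelevance.
have Ns : None \in s by rewrite inE.
have g'v k' : g' (Some (sval (v k'))) = w k' by exact/esym/gP.
rewrite [extend b w]/extend [extend _ v]/extend.
case: unliftP => [j'|] _; case: unliftP => [k'|] _.
- exact: wv.
- split=> [|i].
    rewrite eqE /=; split=> [wb|/eqP]; last by rewrite vnp.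
    by case: nb; exists j'.
  rewrite -(g'v j').
  exact: iff_trans (iff_sym (RP i _ _ (sv j') Ns))
    (iff_trans (iff_sym (gr i _ _ (sv j') Ns)) (r i _ _ (Av j') Ap)).
- split=> [|i].
    rewrite eqE /=; split=> [bw|/esym/eqP]; last by rewrite vnp.
    by case: nb; exists k'.
  rewrite -(g'v k').
  exact: iff_trans (iff_sym (RP i _ _ Ns (sv k')))
    (iff_trans (iff_sym (gr i _ _ Ns (sv k'))) (r i _ _ Ap (Av k'))).
- split=> // i.
  exact: iff_trans (iff_sym (RP i _ _ Ns Ns))
    (iff_trans (iff_sym (gr i _ _ Ns Ns)) (r i _ _ Ap Ap)).
Qed.

(** Adding points one at a time realizes every finite member; back and forth of the union with
    itself extends finite partial isomorphisms. *)
Lemma approx_union_limit : Fraisse_limit (finite_members K) approx_union.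
Proof.
have cM : countable [set: approx_union].
  apply/countable_injP; exists sval => x y _ _ /eq_sig_hprop; apply=> ? ? ?.
  exact: Prop_irrelevance.
have realizes (B : structure I) n (w : 'I_n -> B) :
    K B -> exists v : 'I_n -> approx_union, same_type w v.
  move=> KB; elim: n w => [|n IH] w.
    by exists (@empty_tuple _); exact: same_type0.
  have [v wv] := IH (w \o lift ord0).
  have [x wx] := approx_union_forth KB wv (w ord0).
  by exists (extend x v); rewrite (extend_split w).
have forthM := approx_union_forth approx_union_class.
split=> // [S T f Sfin _ fiso|B].
  have [n [e es]] := finite_setT_enum Sfin.
  have st : same_type (fun k => sval (e k)) (fun k => sval (f (e k))).
    apply: (same_type_trans (w := e)).
      exact/same_type_sym/(embedding_same_type e (induced_on_embedding S)).
    apply: same_type_trans (embedding_same_type e fiso.2) _.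
    exact: (embedding_same_type (f \o e) (induced_on_embedding T)).
  have [h [hiso hE]] := back_and_forth cM cM forthM forthM st.
  by exists h; split=> // x; have [k <-] := es x.
split=> [[Bfin [f fe]]|[KB Bfin]].
  by split=> //; exact: local_embedding fe approx_union_class.
split=> //; have [n [e es]] := finite_setT_enum Bfin.
have [v ev] := realizes B n e KB.
by have [f [fe _]] := same_type_embedding ev es; exists f.
Qed.

End LimitExistence.

(** The injective tuples of every length in members of [K] make the limit infinite, as categoricity
    among countably infinite models requires. *)
Theorem generic_model_completion (I : Type) (K : class I) :
  finite_set [set: I] -> (forall M, locally K M -> K M) -> SAPU K ->
  (forall n, exists (B : structure I) (w : 'I_n -> B), K B /\ injective w) ->
  has_generic_model_completion K.
Proof.
move=> /finite_setT_enum[m [sym sym_surj]] Kloc KSAPU Kbig.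
have [idx idxK] := choice sym_surj.
split; [|split].
- have [B [_ [KB _]]] := Kbig 0.
  have idx_inj : injective (fun i => idx i : nat).
    by move=> i j /val_inj ij; rewrite -(idxK i) -(idxK j) ij.
  have Kinh : exists B, K B by exists B.
  exact: ex_intro (approx_union_limit Kloc KSAPU Kinh idx_inj
    (fun i => ltn_ord (idx i))).
- by eexists; exact: local_axiomatizes Kloc _ _ sym_surj.
move=> M Mlim.
have Minf : infinite_set [set: M].
  move=> /finite_setT_enum[n [e /choice[f fK]]].
  (* A finite [M], enumerated by [n] indices, would contain [n.+1] distinct points. *)
  have [B [w [KB winj]]] := Kbig n.+1.
  have [v wv] := limit_realizes Kloc Mlim w KB.
  have /leq_card : injective (f \o v).
    move=> j k /(congr1 e) /=; rewrite !fK => /(wv j k).1/winj //.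
  by rewrite !card_ord ltnn.
have QE := limit_quantifier_elimination sym_surj Mlim.
split=> //; first exact: limit_omega_categorical Mlim Minf.
move=> T TK; split.
- move=> N NM phi Tphi; apply: NM.
  by have /TK := limit_in_class Kloc Mlim; apply.
- move=> A /TK KA; apply: embedding_into_model.
    by have [x _] := infinite_setN0 Minf; exists.
  by move=> n v; exact: limit_realizes KA.
- move=> A _ N N' f g NM N'M fe ge n phi v.
  (* An equivalent quantifier-free formula depends only on the type of the tuple, which both
     embeddings preserve. *)
  have [psi [qf h]] := QE n phi.
  rewrite h // h //; apply: sat_quantifier_free qf _.
  exact: same_type_trans (same_type_sym (embedding_same_type v fe))
    (embedding_same_type v ge).
Qed.

(** * Amalgamation of orders *)

Section OrderAmalgam.
Variables (U : Type) (A B : set U).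
Implicit Types (ra rb : U -> U -> Prop) (x y z : U).

Definition order_on (S : set U) (r : U -> U -> Prop) : Prop :=
  [/\ forall x, S x -> r x x,
      forall x y z, S x -> S y -> S z -> r x y -> r y z -> r x z &
      forall x y, S x -> S y -> r x y -> r y x -> x = y].

Definition total_on (S : set U) (r : U -> U -> Prop) : Prop :=
  forall x y, S x -> S y -> r x y \/ r y x.

Definition step ra rb x y : Prop :=
  (A x /\ A y /\ ra x y) \/ (B x /\ B y /\ rb x y).

(** For orders that agree on the common part this is the transitive closure of [step]: two steps
    suffice by [step3], and reflexivity pads a single one. *)
Definition order_amalgam ra rb x y : Prop :=
  exists z, step ra rb x z /\ step ra rb z y.

(* Points that the common part does not compare are ordered with those of [A]
below those of [B]. *)
Definition linear_amalgam ra rb x y : Prop :=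
  order_amalgam ra rb x y \/ (A x /\ B y /\ ~ order_amalgam ra rb y x).

Section OneOrder.
Variables ra rb : U -> U -> Prop.
Hypotheses (oA : order_on A ra) (oB : order_on B rb).
Hypothesis agree : forall x y, A x -> A y -> B x -> B y -> (ra x y <-> rb x y).
Local Notation am := (order_amalgam ra rb).
Local Notation lin := (linear_amalgam ra rb).

(** Two steps in [B] compose to one between the end points, which are then common; in a mixed path
    the step in [B] joins common points. Either way [agree] moves it to [A]. *)
Lemma order_amalgam_l x y : A x -> A y -> (am x y <-> ra x y).
Proof.
have [rA tA _] := oA; have [rB tB _] := oB.
move=> Ax Ay; split=> [[z [[[_ [Az xz]]|[Bx [Bz xz]]] [[Az' [_ zy]]|[Bz' [By zy]]]]]|xy].
- exact: tA zy.
- by apply: (tA _ z) xz _ => //; apply/agree.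
- by apply: (tA _ z) zy => //; apply/agree.
- by apply/agree => //; exact: tB zy.
- by exists y; split; left; do !split => //; exact: rA.
Qed.

Lemma order_amalgam_r x y : B x -> B y -> (am x y <-> rb x y).
Proof.
have [rA tA _] := oA; have [rB tB _] := oB.
move=> Bx By; split=> [[z [[[Ax [Az xz]]|[_ [Bz xz]]] [[Az' [Ay zy]]|[Bz' [_ zy]]]]]|xy].
- by apply/agree => //; exact: tA zy.
- by apply: (tB _ z) zy => //; apply/agree.
- by apply: (tB _ z) xz _ => //; apply/agree.
- exact: tB zy.
- by exists y; split; right; do !split => //; exact: rB.
Qed.

(** The first step must stay in the part of its start and the second in the part of its end, so the
    midpoint is common. *)
Lemma order_amalgam_lr x y : A x -> ~ B x -> B y -> ~ A y ->
  (am x y -> exists z, [/\ A z, B z, ra x z & rb z y]) /\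
  (am y x -> exists z, [/\ A z, B z, rb y z & ra z x]).
Proof.
move=> Ax nBx By nAy; split=> -[z [[[? [? ?]]|[? [? ?]]] [[? [? ?]]|[? [? ?]]]]] //;
  by exists z.
Qed.

(* In three consecutive steps two neighbouring ones lie in the same part, unless
the middle one joins two common points. *)
Lemma step3 x y z t :
  step ra rb x y -> step ra rb y z -> step ra rb z t -> am x t.
Proof.
have [rA tA _] := oA; have [rB tB _] := oB.
move=> [[Ax [Ay xy]]|[Bx [By xy]]] [[Ay' [Az yz]]|[By' [Bz yz]]] zt.
- by exists z; split=> //; left; do !split=> //; exact: tA yz.
- case: (zt) => [[Az [At zt']]|[_ [Bt zt']]].
    exists y; split; left; do !split=> //.
    by apply: (tA _ z) zt' => //; apply/agree.
  exists y; split; [by left|right; do !split=> //].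
  exact: tB zt'.
- case: (zt) => [[_ [At zt']]|[Bz [Bt zt']]].
    exists y; split; [by right|left; do !split=> //].
    exact: tA zt'.
  exists y; split; right; do !split=> //.
  by apply: (tB _ z) zt' => //; apply/agree.
- by exists z; split=> //; right; do !split=> //; exact: tB yz.
Qed.

Lemma order_amalgam_trans x y z : am x y -> am y z -> am x z.
Proof.
move=> [u [xu uy]] [v [yv vz]]; have [w [xw wv]] := step3 xu uy yv.
exact: step3 xw wv vz.
Qed.

Lemma order_amalgam_order : order_on (A `|` B) am.
Proof.
have [rA tA aA] := oA; have [rB tB aB] := oB; split.
- move=> x [Ax|Bx]; first exact/order_amalgam_l/rA.
  exact/order_amalgam_r/rB.
- by move=> x y z _ _ _; exact: order_amalgam_trans.
have cross x y : A x -> B y -> am x y -> am y x -> x = y.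
  move=> Ax By; have [Bx|nBx] := pselect (B x).
    by rewrite !order_amalgam_r //; exact: aB.
  have [Ay|nAy] := pselect (A y); first by rewrite !order_amalgam_l //; exact: aA.
  have [h h'] := order_amalgam_lr Ax nBx By nAy.
  move=> /h[z [Az Bz xz zy]] /h'[z' [Az' Bz' yz' z'x]].
  (* In [A], [z'] is below [x] and [x] below [z]; in [B], [z] is below [y] and [y] below [z']. So
     [z] and [z'] coincide, and [y] equals this common point. *)
  have zz' : z = z'.
    apply: aA => //; last exact: tA xz.
    by apply/agree => //; exact: tB yz'.
  by case: nAy; rewrite (aB y z) // zz'.
move=> x y [Ax|Bx] [Ay|By] xy yx.
- by apply: aA => //; exact/order_amalgam_l.
- exact: cross.
- by apply/esym/cross.
- by apply: aB => //; exact/order_amalgam_r.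
Qed.

Hypotheses (totA : total_on A ra) (totB : total_on B rb).

Lemma order_amalgam_total_l x y : A x -> A y -> am x y \/ am y x.
Proof. by move=> Ax Ay; rewrite !order_amalgam_l //; exact: totA. Qed.

Lemma order_amalgam_total_r x y : B x -> B y -> am x y \/ am y x.
Proof. by move=> Bx By; rewrite !order_amalgam_r //; exact: totB. Qed.

Lemma linear_amalgam_l x y : A x -> A y -> (lin x y <-> ra x y).
Proof.
move=> Ax Ay; rewrite -order_amalgam_l //; split=> [[//|[_ [_ nyx]]]|]; last by left.
by have [] := order_amalgam_total_l Ax Ay.
Qed.

Lemma linear_amalgam_r x y : B x -> B y -> (lin x y <-> rb x y).
Proof.
move=> Bx By; rewrite -order_amalgam_r //; split=> [[//|[_ [_ nyx]]]|]; last by left.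
by have [] := order_amalgam_total_r Bx By.
Qed.

Lemma linear_amalgam_total : total_on (A `|` B) lin.
Proof.
have cross x y : A x -> B y -> lin x y \/ lin y x.
  move=> Ax By; have [yx|nyx] := pselect (am y x); first by right; left.
  by left; right.
move=> x y [Ax|Bx] [Ay|By].
- by have [] := order_amalgam_total_l Ax Ay; [left|right]; left.
- exact: cross.
- by have [] := cross _ _ Ay Bx; [right|left].
- by have [] := order_amalgam_total_r Bx By; [left|right]; left.
Qed.

(** For transitivity with one added pair, [am z x] would reverse that pair. So either [x], [z] is
    itself an added pair or both points lie in one part, where [am] is total. Between two added
    pairs the middle point is common, and [am] already compares it with both ends. *)
Lemma linear_amalgam_order : order_on (A `|` B) lin.
Proof.
have [rAm _ aAm] := order_amalgam_order.
have tAm := order_amalgam_trans; split.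
- by move=> x /rAm; left.
- move=> x y z Sx _ Sz [xy|[Ax [By nyx]]] [yz|[Ay [Bz nzy]]].
  + by left; exact: tAm yz.
  + have zx : ~ am z x by move=> zx; apply: nzy; exact: tAm xy.
    case: Sx => [Ax|Bx]; first by right.
    by left; have [] := order_amalgam_total_r Bx Bz.
  + have zx : ~ am z x by move=> zx; apply: nyx; exact: tAm zx.
    case: Sz => [Az|Bz]; last by right.
    by left; have [] := order_amalgam_total_l Ax Az.
  + left; apply: (tAm _ y); first by have [] := order_amalgam_total_l Ax Ay.
    by have [] := order_amalgam_total_r By Bz.
- move=> x y Sx Sy [xy|[Ax [By nyx]]] [yx|[Ay [Bx nxy]]] //.
    exact: aAm.
  by have [] := order_amalgam_total_l Ax Ay.
Qed.

End OneOrder.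

Lemma order_amalgam_mono ra rb ra' rb' :
  (forall x y, A x -> A y -> ra x y -> ra' x y) ->
  (forall x y, B x -> B y -> rb x y -> rb' x y) ->
  forall x y, order_amalgam ra rb x y -> order_amalgam ra' rb' x y.
Proof.
move=> mA mB x y [z [xz zy]]; exists z.
by split; [case: xz|case: zy] => -[? [? ?]]; [left|right|left|right]; do !split=> //;
  [exact: mA|exact: mB|exact: mA|exact: mB].
Qed.

End OrderAmalgam.

(** * Multiposets *)

Section Multiposets.
Variable I : Type.
Implicit Types (F : set (I * I)) (J : set I).

Lemma set_structure_order (U : Type) (A : set_structure I U) i :
  partial_order (@rel_of I A i) <-> order_on (dom A) (srel A i).
Proof.
split=> [[r t a]|[r t a]].
  split=> [x Ax|x y z Ax Ay Az xy yz|x y Ax Ay xy yx].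
  - exact: (r (exist _ x Ax)).
  - exact: (t (exist _ x Ax) (exist _ y Ay) (exist _ z Az)).
  - exact: (congr1 sval (a (exist _ x Ax) (exist _ y Ay) xy yx)).
split=> [[x Ax]|[x Ax] [y Ay] [z Az]|[x Ax] [y Ay]].
- exact: r.
- exact: t.
- by move=> xy yx; apply/eq_exist/a.
Qed.

Lemma set_structure_total (U : Type) (A : set_structure I U) i :
  (forall x y : A, rel_of i x y \/ rel_of i y x) <-> total_on (dom A) (srel A i).
Proof.
split=> [h x y Ax Ay|h [x Ax] [y Ay]]; last exact: h.
exact: (h (exist _ x Ax) (exist _ y Ay)).
Qed.

Lemma set_structure_coarseness (U : Type) (A : set_structure I U) F :
  coarseness F A <-> forall i j, F (i, j) ->
    forall x y, dom A x -> dom A y -> srel A j x y -> srel A i x y.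
Proof.
split=> [h i j Fij x y Ax Ay|h i j Fij [x Ax] [y Ay]]; last exact: h.
exact: (h i j Fij (exist _ x Ax) (exist _ y Ay)).
Qed.

Lemma amalgam_agree (U : Type) (A B C : set_structure I U) :
  substructure C A -> substructure C B -> dom C = dom A `&` dom B ->
  forall i x y, dom A x -> dom A y -> dom B x -> dom B y ->
    (srel A i x y <-> srel B i x y).
Proof.
move=> [_ CA] [_ CB] CE i x y Ax Ay Bx By.
have [Cx Cy] : dom C x /\ dom C y by rewrite CE.
exact: iff_trans (iff_sym (CA i x y Cx Cy)) (CB i x y Cx Cy).
Qed.

(** The amalgam does not depend on [r]: coarseness is monotonicity of the recipe, and the
    interpolation clause is [order_amalgam_lr]. *)
Theorem multiposets_superSAPU F (r : I) : superSAPU r (multiposets F).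
Proof.
move=> U A B C [oA cA] [oB cB] _ CA CB CE.
have agree := amalgam_agree CA CB CE.
have {}oA i : order_on (dom A) (srel A i) by exact/set_structure_order.
have {}oB i : order_on (dom B) (srel B i) by exact/set_structure_order.
move/set_structure_coarseness in cA; move/set_structure_coarseness in cB.
exists (SetStructure (dom A `|` dom B)
  (fun i => order_amalgam (dom A) (dom B) (srel A i) (srel B i))); split.
- split=> [i|]; first exact/set_structure_order/(order_amalgam_order (oA i) (oB i) (agree i)).
  apply/set_structure_coarseness => i j Fij x y _ _.
  by apply: order_amalgam_mono; [exact: cA|exact: cB].
- split=> //; split=> [x|i x y Ax Ay]; try by [left|right].
    exact: iff_sym (order_amalgam_l (oA i) (oB i) (agree i) Ax Ay).
  exact: iff_sym (order_amalgam_r (oA i) (oB i) (agree i) Ax Ay).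
- move=> a b [Aa nBa] [Bb nAb] /=.
  have [h h'] := order_amalgam_lr (srel A r) (srel B r) Aa nBa Bb nAb.
  by split=> [/h|/h'] [c [Ac Bc ac cb]]; exists c; split=> //; rewrite CE.
Qed.

(* Which symbols receive the linear amalgam depends only on the relations in [A]
and [B], so that symbols interpreted alike there are interpreted alike in the
amalgam; a symbol coarser than a linear one coincides with it. *)
Theorem multiposets_linear_SAPU J F : SAPU (multiposets_linear J F).
Proof.
move=> U A B C [[oA cA] lA] [[oB cB] lB] _ CA CB CE.
have agree := amalgam_agree CA CB CE.
have {}oA i : order_on (dom A) (srel A i) by exact/set_structure_order.
have {}oB i : order_on (dom B) (srel B i) by exact/set_structure_order.
move/set_structure_coarseness in cA; move/set_structure_coarseness in cB.
pose total i := total_on (dom A) (srel A i) /\ total_on (dom B) (srel B i).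
have Jtotal j : J j -> total j.
  by move=> Jj; split; apply/set_structure_total; [exact: (lA j Jj).2|exact: (lB j Jj).2].
pose R i := if pselect (total i)
  then linear_amalgam (dom A) (dom B) (srel A i) (srel B i)
  else order_amalgam (dom A) (dom B) (srel A i) (srel B i).
pose D := SetStructure (dom A `|` dom B) R.
have RT i : total i ->
    R i = linear_amalgam (dom A) (dom B) (srel A i) (srel B i).
  by rewrite /R; case: pselect.
have RN i : ~ total i ->
    R i = order_amalgam (dom A) (dom B) (srel A i) (srel B i).
  by rewrite /R; case: pselect.
have oD i : partial_order (@rel_of I D i).
  apply/set_structure_order; rewrite /=; have [/[dup] ti [tA tB]|ti] := pselect (total i).
    rewrite RT //; exact: (linear_amalgam_order (oA i) (oB i) (agree i)).
  rewrite RN //; exact: (order_amalgam_order (oA i) (oB i) (agree i)).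
exists D; split; [split; [split=> //|]|split=> //].
- apply/set_structure_coarseness => i j Fij x y _ _ /=.
  have mA u v : dom A u -> dom A v -> srel A j u v -> srel A i u v by exact: cA.
  have mB u v : dom B u -> dom B v -> srel B j u v -> srel B i u v by exact: cB.
  have mono := order_amalgam_mono mA mB.
  have [tj|ntj] := pselect (total j); last first.
    (* If [j] is not total, its relation is sent by [mono] into [order_amalgam] for [i], which lies
       in either choice of [R i]. *)
    have [ti|nti] := pselect (total i); last by rewrite !RN //; exact: mono.
    by rewrite (RT _ ti) (RN _ ntj) => /mono; left.
  (* A total relation contained in an antisymmetric one equals it: a pair ordered the other way
     would have equal entries. *)
  have coincide S ra ra' : order_on S ra' -> total_on S ra ->
      (forall u v, S u -> S v -> ra u v -> ra' u v) ->
      forall u v, S u -> S v -> ra' u v -> ra u v.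
    move=> [_ _ anti] tot sub u v Su Sv uv; have [//|vu] := tot u v Su Sv.
    have E : u = v by apply: anti => //; exact: sub.
    by move: vu; rewrite E.
  have ti : total i.
    by case: tj => tA tB; split=> u v Su Sv;
      [have [] := tA u v Su Sv|have [] := tB u v Su Sv]; move=> uv; [left|right|left|right]; auto.
  rewrite (RT _ tj) (RT _ ti) => -[/mono|[Ax [By nyx]]]; first by left.
  (* The negated clause reverses inclusions, so the converse inclusions given by [coincide] enter
     here. *)
  right; do !split=> //; apply: contra_not nyx; apply: order_amalgam_mono.
    exact: coincide (oA i) tj.1 mA.
  exact: coincide (oB i) tj.2 mB.
- move=> j /Jtotal tj; split; first exact: oD.
  apply/set_structure_total; rewrite /= RT //; case: tj => tA tB.
  exact: (linear_amalgam_total (oA j) (oB j) (agree j)).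
- split=> [x|i x y Ax Ay]; first by left.
  rewrite /=; apply: iff_sym; have [/[dup] ti [tA tB]|ti] := pselect (total i).
    by rewrite RT //; exact: linear_amalgam_l (oA i) (oB i) (agree i) tA _ _ Ax Ay.
  by rewrite RN //; exact: order_amalgam_l (oA i) (oB i) (agree i) _ _ Ax Ay.
- split=> [x|i x y Bx By]; first by right.
  rewrite /=; apply: iff_sym; have [/[dup] ti [tA tB]|ti] := pselect (total i).
    by rewrite RT //; exact: linear_amalgam_r (oA i) (oB i) (agree i) tB _ _ Bx By.
  by rewrite RN //; exact: order_amalgam_r (oA i) (oB i) (agree i) _ _ Bx By.
Qed.

Lemma multiposets_linear_embedding J F (A B : structure I) (f : A -> B) :
  embedding f -> multiposets_linear J F B -> multiposets_linear J F A.
Proof.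
move=> [finj fr] [[oB cB] lB].
have oA i : partial_order (@rel_of I A i).
  have [r t a] := oB i; split=> [x|x y z|x y].
  - exact/fr/r.
  - by move=> /fr xy /fr yz; apply/fr; exact: t yz.
  - by move=> /fr xy /fr yx; apply/finj/a.
split; first by split=> // i j Fij x y /fr xy; exact/fr/(cB _ _ Fij).
move=> j /lB[_ tot]; split=> // x y.
by have [/fr|/fr] := tot (f x) (f y); [left|right].
Qed.

(** Each axiom is universal and speaks of at most three points, so it can be checked in the range of
    a triple. *)
Lemma multiposets_linear_local J F (M : structure I) :
  locally (multiposets_linear J F) M -> multiposets_linear J F M.
Proof.
move=> loc.
have finite_part x y z : exists S : set M,
    [/\ S x, S y, S z & multiposets_linear J F (induced_on S)].
  pose v (k : 'I_3) := nth x [:: x; y; z] k; exists (range v).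
  split; [by exists (inord 0) => //; rewrite /v inordK|
          by exists (inord 1) => //; rewrite /v inordK|
          by exists (inord 2) => //; rewrite /v inordK|].
  have [B [w [KB vw]]] := loc 3 v.
  have [f [fe _]] := same_type_embedding
    (same_type_trans (same_type_sym (same_type_range v)) vw) (@range_tuple_surj _ _ _ v).
  exact: multiposets_linear_embedding fe KB.
have ord i : partial_order (@rel_of I M i).
  split=> [x|x y z|x y].
  - have [S [Sx _ _ [[/(_ i)/set_structure_order[r _ _] _] _]]] := finite_part x x x.
    exact: r.
  - have [S [Sx Sy Sz [[/(_ i)/set_structure_order[_ t _] _] _]]] := finite_part x y z.
    exact: t.
  - have [S [Sx Sy _ [[/(_ i)/set_structure_order[_ _ a] _] _]]] := finite_part x y y.
    exact: a.
split.
  split=> // i j Fij x y.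
  have [S [Sx Sy _ [[_ /set_structure_coarseness c] _]]] := finite_part x y y.
  exact: c Fij x y Sx Sy.
move=> j Jj; split=> // x y.
have [S [Sx Sy _ [_ /(_ j Jj)[_ /set_structure_total t]]]] := finite_part x y y.
exact: t.
Qed.

(** Interpreting all symbols by one linear order meets every coarseness condition and gives members
    of every finite size. *)
Lemma multiposets_linear_chain J F n :
  multiposets_linear J F (Structure (fun (_ : I) (x y : 'I_n) => x <= y)).
Proof.
have o : partial_order (fun x y : 'I_n => x <= y).
  split=> [x|x y z|x y]; [exact: leqnn|exact: leq_trans|].
  by move=> xy yx; apply/val_inj/anti_leq; rewrite xy.
do !split=> //; try exact: o.
by move=> x y; exact/orP/leq_total.
Qed.

Theorem multiposets_linear_generic J F :
  finite_set [set: I] -> has_generic_model_completion (multiposets_linear J F).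
Proof.
move=> Ifin; apply: generic_model_completion => //.
- exact: multiposets_linear_local.
- exact: multiposets_linear_SAPU.
- move=> n; exists (Structure (fun (_ : I) (x y : 'I_n) => x <= y)), id.
  by split=> //; exact: multiposets_linear_chain.
Qed.

Lemma multiposetsE F : multiposets F = multiposets_linear set0 F.
Proof. by apply/funext => M; apply/propext; split=> [|[]]. Qed.

End Multiposets.

Lemma linearly_extended_posetsE : linearly_extended_posets =
  multiposets_linear [set le'_sym] [set (le'_sym, le_sym)].
Proof.
apply/funext => M; apply/propext; split=> [[o [o' tot] sub]|[[o sub] lin]].
  split; last by move=> _ ->.
  by split=> [[]|i j [-> ->]].
by split; [exact: o|exact: lin|exact: sub].
Qed.

Theorem theorem4p2 (I : Type) :
  (forall F : set (I * I),
     SAPU (multiposets F) /\ (forall i : I, superSAPU i (multiposets F))) /\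
  (forall (J : set I) (F : set (I * I)), SAPU (multiposets_linear J F)) /\
  SAPU linearly_extended_posets /\
  (finite_set [set: I]%classic ->
     (forall F : set (I * I), has_generic_model_completion (multiposets F)) /\
     (forall (J : set I) (F : set (I * I)),
        has_generic_model_completion (multiposets_linear J F))) /\
  has_generic_model_completion linearly_extended_posets.
Proof.
split; [|split; [|split; [|split]]].
- move=> F; split; last exact: multiposets_superSAPU.
  by rewrite multiposetsE; exact: multiposets_linear_SAPU.
- exact: multiposets_linear_SAPU.
- by rewrite linearly_extended_posetsE; exact: multiposets_linear_SAPU.
- move=> Ifin; split=> [F|J F]; last exact: multiposets_linear_generic.
  by rewrite multiposetsE; exact: multiposets_linear_generic.
- rewrite linearly_extended_posetsE; apply: multiposets_linear_generic.
  apply: (@enum_finite_setT _ 2 (fun k => if k == ord0 then le_sym else le'_sym)).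
  by case; [exists ord0|exists ord_max].
Qed.
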